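(* Let $k\ge 4$. Among the $k-2$ images in $\mathrm{gr}^{W,L}_{k,2}(\mathcal{MD}^{adm})$ of the admissible brackets $[s_1,s_2]$ with $s_1\ge 2$, $s_2\ge1$, $s_1+s_2=k$, there are at least $\lfloor k/2\rfloor-1$ linearly independent linear relations over $\mathbb{Q}$ (i.e. the space of $(c_{s_1,s_2})\in\mathbb{Q}^{k-2}$ with $\sum c_{s_1,s_2}[s_1,s_2]=0$ in $\mathrm{gr}^{W,L}_{k,2}(\mathcal{MD}^{adm})$ has dimension at least $\lfloor k/2\rfloor-1$).
   Context: For integers $r_1,\dots,r_l\ge 0$ and $n\ge 1$ let $\sigma_{r_1,\dots,r_l}(n)=\sum v_1^{r_1}\cdots v_l^{r_l}$, summed over positive integers $u_1>\dots>u_l>0$, $v_1,\dots,v_l>0$ with $u_1v_1+\dots+u_lv_l=n$. For integers $s_1,\dots,s_l\ge1$ the bracket is $[s_1,\dots,s_l]=\frac{1}{(s_1-1)!\cdots(s_l-1)!}\sum_{n>0}\sigma_{s_1-1,\dots,s_l-1}(n)q^n\in\mathbb{Q}[[q]]$, of weight $s_1+\dots+s_l$ and length $l$ ($1$ has weight and length $0$). A bracket is admissible if $s_1>1$. $\mathcal{MD}^{adm}$ is the $\mathbb{Q}$-span of $1$ and all admissible brackets, $\mathrm{Fil}^{W,L}_{k,l}(\mathcal{MD}^{adm})$ the span of $1$ and admissible brackets of weight $\le k$ and length $\le l$, and $\mathrm{gr}^{W,L}_{k,l}(\mathcal{MD}^{adm})=\mathrm{Fil}^{W,L}_{k,l}(\mathcal{MD}^{adm})\big/\big(\mathrm{Fil}^{W,L}_{k-1,l}(\mathcal{MD}^{adm})+\mathrm{Fil}^{W,L}_{k,l-1}(\mathcal{MD}^{adm})\big)$.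 *)

(* Defs.v *)
From mathcomp Require Import all_boot all_order all_algebra.
From mathcomp Require Import boolp classical_sets functions.
Set Implicit Arguments.
Unset Strict Implicit.
Unset Printing Implicit Defensive.
Import Order.TTheory GRing.Theory Num.Theory.
Local Open Scope classical_set_scope.
Local Open Scope ring_scope.

(* Q[[q]] as a Q-vector space: f n is the coefficient of q^n.  The regular
   module rat^o makes nat -> rat^o an lmodType rat with pointwise operations. *)
Notation qseries := (nat -> rat^o).

Definition qone : qseries := fun n => (n == 0)%N%:R.

(* u_i v_i <= n with u_i, v_i > 0 forces u_i, v_i <= n, so that letting them
   range over {0, ..., n} loses nothing. *)
Definition sigma (r : seq nat) (n : nat) : nat :=
  (\sum_(u : {ffun 'I_(size r) -> 'I_n.+1})
   \sum_(v : {ffun 'I_(size r) -> 'I_n.+1} |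
         [&& [forall i : 'I_(size r), forall j : 'I_(size r), (i < j) ==> (u j < u i)],
             [forall i, 0 < u i], [forall i, 0 < v i]
           & \sum_i u i * v i == n])
     \prod_i v i ^ nth 0 r i)%N.

(* The constant coefficient is 0, even for s = [::]: the unit series qone is
   not a value of bracket. *)
Definition bracket (s : seq nat) : qseries := fun n =>
  if (0 < n)%N
  then (sigma (map predn s) n)%:R / (\prod_(a <- s) (a.-1)`!)%:R
  else 0.

(* s is a nonempty index with all entries >= 1 and first entry > 1. *)
Definition admissible (s : seq nat) : bool :=
  all (leq 1) s && (1 < head 0 s)%N.

Definition lin_span (V : lmodType rat) (A : set V) : set V :=
  [set x | exists (m : nat) (a : 'I_m -> rat) (b : 'I_m -> V),
     (forall i, A (b i)) /\ x = \sum_i a i *: b i].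

Definition Fil_adm (k l : nat) : set qseries :=
  lin_span ([set qone] `|`
    [set bracket s | s in [set s : seq nat |
       [&& admissible s, sumn s <= k & size s <= l]%N]]).

(* Truncated predecessors are harmless: at k = 0 or l = 0 the lower
   filtration step is still the span of qone, since no admissible index has
   weight or length 0. *)
Definition gr_denom (k l : nat) : set qseries :=
  [set x + y | x in Fil_adm k.-1 l & y in Fil_adm k l.-1].

(* Equality of the classes of f and g in the quotient
   gr_(k,l) = Fil_(k,l) / (Fil_(k-1,l) + Fil_(k,l-1)). *)
Definition gr_eq (k l : nat) (f g : qseries) : Prop :=
  [/\ Fil_adm k l f, Fil_adm k l g & gr_denom k l (f - g)].

(* The coordinate j : 'I_(k - 2) stands for the pair (s1, s2) = (j + 2,
   k - (j + 2)), so that s1 runs over 2, ..., k - 1. *)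
Definition gr_relation (k : nat) (c : 'rV[rat]_(k - 2)) : Prop :=
  gr_eq k 2
    (\sum_(j < k - 2) c ord0 j *: bracket [:: j + 2; k - (j + 2)]%N) 0.

(* Main.v *)
Require Import Defs.
From HB Require Import structures.
From mathcomp Require Import all_boot all_order all_algebra.
From mathcomp Require Import boolp classical_sets functions.
From mathcomp Require Import zify ring.
Set Implicit Arguments.
Unset Strict Implicit.
Unset Printing Implicit Defensive.
Import Order.TTheory GRing.Theory Num.Theory.
Local Open Scope ring_scope.

(** Put [n = k - 2] and let [F(x, y) = sum_i mu_i x^i y^(n-i) / (i! (n-i)!)] be
    symmetric with [F(x, x) = 0].  Sum [F(v1, v2) q^(u1 v1 + u2 v2)] over all
    positive [u1, u2, v1, v2].  Splitting according to the order of [u1, u2]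
    (stuffle) gives twice the sum over [u1 > u2] plus the diagonal [u1 = u2];
    splitting according to the order of [v1, v2] and conjugating partitions
    (shuffle) gives twice the sum of [F(v1 + v2, v1)] over [u1 > u2], the
    diagonal [v1 = v2] contributing nothing because [F(x, x) = 0].  This
    condition on [F] is what removes the derivative of [[k - 2]] which a single
    product of two brackets would leave.  The difference
    [F(x + y, x) - F(x, y)] has coefficients [sum_(m < i) C(i, m) mu_m], so it
    gives a combination of admissible brackets of weight [k] and length 2; the
    diagonal [u1 = u2] is, by Faulhaber, a combination of admissible brackets
    of length 1 and weight at most [k], hence zero in the graded piece.  A
    symmetric [mu] with [F(x, x) = 0] is determined by the free values
    [mu_1, ..., mu_(n/2)], and [mu |-> (sum_(m < i) C(i, m) mu_m)_i] is
    triangular with nonzero diagonal, so the relations are independent. *)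

(** * Spans and filtrations *)

Lemma lin_span_gen (V : lmodType rat) (A : set V) x : A x -> lin_span A x.
Proof.
move=> Ax; exists 1%N, (fun=> 1), (fun=> x); split => //.
by rewrite big_ord1 scale1r.
Qed.

Lemma lin_span0 (V : lmodType rat) (A : set V) : lin_span A 0.
Proof. by exists 0%N, (fun=> 0), (fun=> 0); split => [[]|] //; rewrite big_ord0. Qed.

Lemma lin_spanZ (V : lmodType rat) (A : set V) a x :
  lin_span A x -> lin_span A (a *: x).
Proof.
move=> [m [c [b [Ab ->]]]]; exists m, (fun i => a * c i), b; split=> //.
by rewrite scaler_sumr; apply: eq_bigr => i _; rewrite scalerA.
Qed.

Lemma lin_spanD (V : lmodType rat) (A : set V) x y :
  lin_span A x -> lin_span A y -> lin_span A (x + y).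
Proof.
move=> [m [a [b [Ab ->]]]] [m' [a' [b' [Ab' ->]]]].
exists (m + m')%N,
  (fun i => match fintype.split i with inl j => a j | inr j => a' j end),
  (fun i => match fintype.split i with inl j => b j | inr j => b' j end); split.
  by move=> i; case: fintype.split.
rewrite big_split_ord /=; congr (_ + _); apply: eq_bigr => i _.
  by rewrite (unsplitK (inl i)).
by rewrite (unsplitK (inr i)).
Qed.

Lemma lin_span_sum (V : lmodType rat) (A : set V) (I : Type) (r : seq I)
    (P : pred I) (F : I -> V) :
  (forall i, P i -> lin_span A (F i)) -> lin_span A (\sum_(i <- r | P i) F i).
Proof.
by move=> AF; apply: big_ind => //; [exact: lin_span0|exact: lin_spanD].
Qed.

Lemma gr_denomP k l a f g :
  gr_denom k l f -> gr_denom k l g -> gr_denom k l (a *: f + g).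
Proof.
move=> [x Fx [y Fy <-]] [x' Fx' [y' Fy' <-]].
exists (a *: x + x'); first by apply: lin_spanD => //; apply: lin_spanZ.
exists (a *: y + y'); first by apply: lin_spanD => //; apply: lin_spanZ.
by rewrite scalerDr addrACA.
Qed.

Lemma gr_denom0 k l : gr_denom k l 0.
Proof. by exists 0; [|exists 0]; rewrite ?addr0//; exact: lin_span0. Qed.

Lemma Fil_adm_gr_denom k l f : Fil_adm k l.-1 f -> gr_denom k l f.
Proof. by exists 0; [exact: lin_span0|exists f; rewrite ?add0r]. Qed.

Lemma Fil_adm_bracket k l s :
  admissible s -> (sumn s <= k)%N -> (size s <= l)%N -> Fil_adm k l (bracket s).
Proof.
by move=> As sk sl; apply: lin_span_gen; right; exists s => //=; rewrite As sk.
Qed.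

Definition bracket_comb k (c : 'rV[rat]_(k - 2)) : qseries :=
  \sum_(j < k - 2) c ord0 j *: bracket [:: j + 2; k - (j + 2)]%N.

Lemma bracket_combP k a (c d : 'rV[rat]_(k - 2)) :
  bracket_comb (a *: c + d) = a *: bracket_comb c + bracket_comb d.
Proof.
rewrite /bracket_comb scaler_sumr -big_split; apply: eq_bigr => j _ /=.
by rewrite !mxE scalerDl scalerA.
Qed.

Lemma bracket_comb0 k : bracket_comb (0 : 'rV[rat]_(k - 2)) = 0.
Proof. by rewrite /bracket_comb big1 // => j _; rewrite mxE scale0r. Qed.

(** Every bracket in the sum is admissible of weight [k] and length 2, so the membership conditions
    of [gr_eq] are automatic. *)
Lemma gr_relationE k (c : 'rV[rat]_(k - 2)) :
  gr_relation c <-> gr_denom k 2 (bracket_comb c).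
Proof.
split; first by move=> [_ _]; rewrite subr0.
move=> kc; split; [|exact: lin_span0|by rewrite subr0].
apply: lin_span_sum => j _; apply: lin_spanZ; have := ltn_ord j => jk.
by apply: Fil_adm_bracket; rewrite /admissible /=; lia.
Qed.

(** Take a subspace of maximal dimension among those inside [P]: adjoining to it a vector of [P]
    stays inside [P], so by maximality the vector was already there. *)
Lemma vspace_of_prop (K : fieldType) (V : vectType K) (P : V -> Prop) :
  P 0 -> (forall a x y, P x -> P y -> P (a *: x + y)) ->
  exists U : {vspace V}, forall x, x \in U <-> P x.
Proof.
move=> P0 PD.
pose Q d := `[< exists U : {vspace V}, \dim U = d /\ forall x, x \in U -> P x >].
have exQ : exists d, Q d.
  exists 0%N; apply/asboolP; exists 0%VS; split; first by rewrite dimv0.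
  by move=> x; rewrite memv0 => /eqP ->.
have ubQ d : Q d -> (d <= dim V)%N.
  by move=> /asboolP [U [<- _]]; rewrite -dimvf dimvS ?subvf.
case: (ex_maxnP exQ ubQ) => d /asboolP [U [dU UP]] maxd.
exists U => x; split; first exact: UP.
move=> Px; apply: contrapT => /negP xU.
suff : (\dim (<[x]> + U) <= d)%N.
  rewrite -dU => le; have /eqP : U == (<[x]> + U)%VS by rewrite eqEdim addvSr.
  by move=> E; move: xU; rewrite E (subvP (addvSl _ _)) // memv_line.
apply: maxd; apply/asboolP; exists (<[x]> + U)%VS; split => // y.
by move=> /memv_addP [_ /vlineP [a ->] [u uU ->]]; apply: PD => //; exact: UP.
Qed.

(** * Sums of powers *)

(** Telescoping gives [w ^ m.+1] as the sum over [l <= m] of ['C(m.+1, l)] times the [l]-th power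
    sum; this is solved for the term [l = m]. *)
Lemma faulhaber (m : nat) : exists p : {poly rat},
  [/\ (size p <= m.+2)%N, p.[0] = 0 &
      forall w : nat, p.[w%:R] = \sum_(v < w) v%:R ^+ m].
Proof.
elim/ltn_ind: m => m IH.
have /fin_all_exists [P PE] (l : 'I_m) : exists p : {poly rat},
    [/\ (size p <= l.+2)%N, p.[0] = 0 &
      forall w : nat, p.[w%:R] = \sum_(v < w) v%:R ^+ l] by exact: IH.
exists ((m.+1%:R^-1 : rat) *: ('X^(m.+1) - \sum_(l < m) P l *+ 'C(m.+1, l))); split.
- apply: (leq_trans (size_scale_leq _ _)); apply: (leq_trans (size_polyD _ _)).
  rewrite geq_max size_polyXn leqnn size_polyN /=.
  apply: (leq_trans (size_sum _ _ _)); apply/bigmax_leqP => l _.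
  rewrite -scaler_nat; apply: (leq_trans (size_scale_leq _ _)).
  by have [s _ _] := PE l; apply: (leq_trans s); have := ltn_ord l; lia.
- rewrite !hornerE horner_sum big1 ?expr0n ?subr0 ?mulr0 //= => l _.
  by rewrite hornerMn; have [_ -> _] := PE l; rewrite mul0rn.
- move=> w; rewrite !hornerE horner_sum.
  have -> : w%:R ^+ m.+1 = \sum_(v < w) \sum_(l < m.+1)
      (v%:R ^+ l *+ 'C(m.+1, l)) :> rat.
    elim: w => [|w IHw]; first by rewrite big_ord0 expr0n.
    rewrite big_ord_recr -IHw /= -natr1 [w%:R + 1]addrC exprDn big_ord_recr /= subnn.
    rewrite addrC; congr (_ + _); first by rewrite binn mulr1n expr0 mul1r.
    by apply: eq_bigr => l _; rewrite expr1n mul1r.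
  under [X in _ * (_ - X)]eq_bigr => l _.
    have [_ _ E] := PE l; rewrite hornerMn E -sumrMnl; over.
  rewrite [X in _ - X]exchange_big -sumrB mulr_sumr /=; apply: eq_bigr => v _.
  by rewrite big_ord_recr /= addrAC subrr add0r binSn
    -[_ ^+ _ *+ _]mulr_natr mulrCA mulVf ?mulr1 // pnatr_eq0.
Qed.

(** Expanding [(w - v) ^ j] reduces to power sums in [v]. Those start at [v = 0], so the term
    [0 ^ i * w ^ j] is subtracted; [0 < i + j] makes it vanish at [w = 0]. *)
Lemma power_convolution (i j : nat) : (0 < i + j)%N -> exists p : {poly rat},
  [/\ (size p <= (i + j).+2)%N, p.[0] = 0 &
      forall w : nat, p.[w%:R] =
        \sum_(v < w | (0 < v)%N) v%:R ^+ i * (w - v)%:R ^+ j].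
Proof.
move=> ij.
have /fin_all_exists [P PE] (l : 'I_j.+1) : exists p : {poly rat},
    [/\ (size p <= (i + l).+2)%N, p.[0] = 0 &
      forall w : nat, p.[w%:R] = \sum_(v < w) v%:R ^+ (i + l)].
  by exact: faulhaber.
exists (\sum_(l < j.+1) (-1) ^+ l *+ 'C(j, l) *: ('X^(j - l) * P l)
        - (0 ^+ i) *: 'X^j); split.
- apply: (leq_trans (size_polyD _ _)); rewrite geq_max size_polyN.
  apply/andP; split; last first.
    by apply: (leq_trans (size_scale_leq _ _)); rewrite size_polyXn; lia.
  apply: (leq_trans (size_sum _ _ _)); apply/bigmax_leqP => l _.
  apply: (leq_trans (size_scale_leq _ _)); apply: (leq_trans (size_polyMleq _ _)).
  by rewrite size_polyXn; have [s _ _] := PE l; have := ltn_ord l; lia.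
- rewrite !hornerE horner_sum big1 ?sub0r.
    by rewrite -exprD expr0n; case: (i + j)%N ij => //; rewrite oppr0.
  by move=> l _; have [_ E0 _] := PE l; rewrite hornerZ hornerM E0 !mulr0.
- move=> [|w].
    rewrite big_ord0 hornerD hornerN hornerZ hornerXn -exprD expr0n.
    rewrite (gtn_eqF ij) subr0 horner_sum big1 // => l _.
    by have [_ E0 _] := PE l; rewrite hornerZ hornerM E0 !mulr0.
  rewrite hornerD hornerN hornerZ hornerXn horner_sum.
  apply/eqP; rewrite subr_eq; apply/eqP.
  transitivity (\sum_(v < w.+1) v%:R ^+ i * (w.+1 - v)%:R ^+ j : rat); last first.
    rewrite (bigID (fun v : 'I__ => 0 < v)%N) /=; congr (_ + _).
    rewrite (big_pred1 ord0) ?subn0 // => v.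
    by rewrite -leqNgt leqn0.
  under eq_bigr => l _ do
    (have [_ _ E] := PE l; rewrite hornerZ hornerM hornerXn E !mulr_sumr).
  rewrite exchange_big /=; apply: eq_bigr => v _.
  rewrite natrB ?(ltnW (ltn_ord v)) // exprBn mulr_sumr; apply: eq_bigr => l _.
  by rewrite exprD mulrnAl mulrnAr; congr (_ *+ _); ring.
Qed.

(** * Partitions with two part sizes *)

Section TwoColumns.
Variable N : nat.
Local Notation I := 'I_N.+1.
Local Notation quad := ((I * I) * (I * I))%type.

(** With [p = ((u1, u2), (v1, v2))], the part sizes are [u1], [u2] and their multiplicities [v1],
    [v2]. *)
Definition two_col (p : quad) : bool :=
  [&& (0 < p.1.1)%N, (0 < p.1.2)%N, (0 < p.2.1)%N, (0 < p.2.2)%N &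
   (p.1.1 * p.2.1 + p.1.2 * p.2.2 == N)%N].

Definition swap_col (p : quad) : quad := ((p.1.2, p.1.1), (p.2.2, p.2.1)).

Definition strict_sum (F : nat -> nat -> rat) : rat :=
  \sum_(p : quad | two_col p && (p.1.2 < p.1.1)%N) F p.2.1 p.2.2.

Lemma swap_colK : involutive swap_col.
Proof. by case=> [[? ?] [? ?]]. Qed.

Lemma two_col_swap p : two_col (swap_col p) = two_col p.
Proof. by rewrite /two_col /= addnC !andbA; congr (_ && _); lia. Qed.

(** Swapping the columns exchanges the regions [g < f] and [f < g]. The choice [f = u1] gives the
    stuffle splitting, [f = v1] the shuffle splitting. *)
Lemma two_col_trichotomy (f : quad -> nat) (F : quad -> rat) (g := f \o swap_col) :
  (forall p, F (swap_col p) = F p) ->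
  \sum_(p | two_col p) F p =
    (\sum_(p | two_col p && (g p < f p)%N) F p) *+ 2 +
    \sum_(p | two_col p && (f p == g p)) F p.
Proof.
move=> FC; rewrite (bigID (fun p => g p < f p)%N) /= mulr2n -addrA; congr (_ + _).
rewrite (bigID (fun p => f p < g p)%N) /=; congr (_ + _).
  rewrite (reindex_inj (inv_inj swap_colK)) /=.
  apply: eq_big => [p|p _]; last exact: FC.
  by rewrite two_col_swap -andbA /g /= swap_colK; congr (_ && _); lia.
by apply: eq_bigl => p; rewrite -andbA; congr (_ && _); rewrite /=; lia.
Qed.

(* Conjugation of partitions with two distinct part sizes. *)
Lemma strict_sum_conj (F : nat -> nat -> rat) :
  \sum_(p : quad | two_col p && (p.2.2 < p.2.1)%N) F p.2.1 p.2.2 =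
  strict_sum (fun x y => F (x + y)%N x).
Proof.
(* The total is preserved: [u2 * (v1 + v2) + (u1 - u2) * v1 = u1 * v1 + u2 * v2]. *)
pose h (p : quad) : quad :=
  ((p.1.2, inord (p.1.1 - p.1.2)%N), (inord (p.2.1 + p.2.2)%N, p.2.1)).
pose h' (p : quad) : quad :=
  ((inord (p.1.1 + p.1.2)%N, p.1.1), (p.2.2, inord (p.2.1 - p.2.2)%N)).
have bnd (x y a b : nat) : (0 < a -> 0 < b -> x * a + y * b = N -> x + y <= N)%N.
  by move=> a0 b0 <-; rewrite leq_add // leq_pmulr.
have vM (x y : I) : (inord (x - y)%N : I) = (x - y)%N :> nat.
  by rewrite inordK //; have := ltn_ord x; lia.
(* An overflowing [inord] returns 0, so the positivity required by [two_col] excludes overflow. *)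
have vD (x y : I) : (0 < (inord (x + y)%N : I))%N ->
    (inord (x + y)%N : I) = (x + y)%N :> nat.
  have [xy|xy] := ltnP (x + y) N.+1; first by rewrite inordK.
  by rewrite /inord /insubd insubN //= -leqNgt.
rewrite (reindex_onto h h') /=; last first.
  case=> [[u1 u2] [v1 v2]] /andP [/and5P /= [u10 u20 v10 v20 /eqP E] lt].
  have b := bnd _ _ _ _ v10 v20 E.
  have [l1 l2] := (ltn_ord v1, ltn_ord v2).
  by congr ((_, _), (_, _)); apply: val_inj; rewrite /= ?inordK ?vM //; lia.
rewrite /strict_sum; apply: eq_big => [|p]; last first.
  by move=> /andP [/andP [/and5P [_ _ /= /vD -> _ _] _] _].
case=> [[U1 U2] [V1 V2]]; apply/idP/idP.
  move=> /andP [/andP [/and5P /= [u10 u20 v10 v20 /eqP E] lt] /eqP [E1 E2]].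
  move: E lt u20; rewrite vM (vD _ _ v10) /two_col /= => E lt u20.
  by rewrite v20; nia.
move=> /andP [/and5P /= [u10 u20 v10 v20 /eqP E] lt].
have b : (V1 + V2 <= N)%N by apply: (bnd _ _ _ _ u10 u20); rewrite mulnC (mulnC V2).
apply/andP; split.
  by rewrite /two_col /= vM inordK //; nia.
have [l1 l2] := (ltn_ord U1, ltn_ord U2).
by apply/eqP; congr ((_, _), (_, _)); apply: val_inj;
  rewrite /= ?vM inordK ?vM // ?inordK //; lia.
Qed.

Lemma strict_sum_relation (F : nat -> nat -> rat) :
  (forall x y, F x y = F y x) -> (forall x, F x x = 0) ->
  (strict_sum (fun x y => F (x + y)%N x - F x y)) *+ 2 =
  \sum_(p : quad | two_col p && (p.1.1 == p.1.2)) F p.2.1 p.2.2.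
Proof.
move=> FC F0; pose G (p : quad) := F p.2.1 p.2.2.
have GC p : G (swap_col p) = G p by rewrite /G FC.
have := two_col_trichotomy (fun p => val p.1.1) GC.
rewrite (two_col_trichotomy (fun p => val p.2.1) GC) /=.
rewrite [X in X *+ 2 + _]strict_sum_conj.
rewrite [X in _ + X = _]big1; last first.
  by move=> p /andP [_ /eqP /= E]; rewrite /G E F0.
rewrite addr0 /strict_sum sumrB mulrnBl => ->.
by rewrite addrC addKr.
Qed.

End TwoColumns.

(** * Coefficients of brackets of length at most two *)

Section FfunPair.
Variables (T : finType).

(** Turns the sums over finite functions in [sigma] into sums over pairs. *)
Definition ffun_of_pair (x : T * T) : {ffun 'I_2 -> T} :=
  [ffun i => if i == ord0 then x.1 else x.2].

Lemma ffun_of_pair_bij : bijective ffun_of_pair.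
Proof.
exists (fun f : {ffun 'I_2 -> T} => (f ord0, f (lift ord0 ord0))) => [[x y]|f].
  by rewrite !ffunE.
apply/ffunP => i; rewrite ffunE; case: eqP => [->//|/eqP i0].
by congr (f _); apply: val_inj => /=; case: i i0 => [[|[]]].
Qed.

Definition ffun_of_elt (x : T) : {ffun 'I_1 -> T} := [ffun=> x].

Lemma ffun_of_elt_bij : bijective ffun_of_elt.
Proof.
exists (fun f : {ffun 'I_1 -> T} => f ord0) => [x|f]; first by rewrite ffunE.
by apply/ffunP => i; rewrite ffunE (ord1 i).
Qed.
End FfunPair.

Lemma forall_ord1 (P : pred 'I_1) : [forall i, P i] = P ord0.
Proof.
by apply/forallP/idP => [/(_ ord0)//|P0 i]; rewrite (ord1 i).
Qed.

Lemma forall_ord2 (P : pred 'I_2) :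
  [forall i, P i] = P ord0 && P (lift ord0 ord0).
Proof.
apply/forallP/andP => [H|[P0 P1] i]; first by split.
by case: (unliftP ord0 i) => [j ->|->//]; rewrite (ord1 j).
Qed.

Lemma sigma1E (a N : nat) :
  sigma [:: a] N =
  (\sum_(u < N.+1) \sum_(v < N.+1 | [&& 0 < u, 0 < v & u * v == N]) v ^ a)%N.
Proof.
rewrite /sigma /= (reindex _ (onW_bij _ (ffun_of_elt_bij _))) /=.
apply: eq_bigr => u _.
rewrite (reindex _ (onW_bij _ (ffun_of_elt_bij _))) /=.
apply: eq_big => [v|v _]; last by rewrite big_ord1 ffunE.
by rewrite !forall_ord1 big_ord1 !ffunE.
Qed.

Lemma sigma2E (a b N : nat) :
  (sigma [:: a; b] N)%:R = strict_sum N (fun x y => x%:R ^+ a * y%:R ^+ b).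
Proof.
rewrite /sigma /strict_sum /= (reindex _ (onW_bij _ (ffun_of_pair_bij _))) /=.
under eq_bigr => u _ do
  rewrite (reindex _ (onW_bij _ (ffun_of_pair_bij _))) /=.
rewrite (pair_big_dep xpredT) /= natr_sum; apply: eq_big => [[[u1 u2] [v1 v2]]|p _].
  rewrite !forall_ord2 big_ord_recl big_ord1 !ffunE /= /two_col /=.
  by rewrite andbT -!andbA andbC -!andbA.
by rewrite big_ord_recl big_ord1 !ffunE /= natrM !natrX.
Qed.

Lemma bracket2E (a b N : nat) : (0 < N)%N ->
  bracket [:: a.+1; b.+1] N =
  strict_sum N (fun x y => x%:R ^+ a / a`!%:R * (y%:R ^+ b / b`!%:R)).
Proof.
move=> N0; rewrite /bracket N0 /= sigma2E !big_cons big_nil muln1 natrM /=.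
rewrite /strict_sum mulr_suml; apply: eq_bigr => p _.
by rewrite invfM mulrACA.
Qed.

Lemma strict_sum_sum N (I : Type) (r : seq I) (c : I -> rat)
    (F : I -> nat -> nat -> rat) :
  strict_sum N (fun x y => \sum_(i <- r) c i * F i x y) =
  \sum_(i <- r) c i * strict_sum N (F i).
Proof.
rewrite /strict_sum exchange_big /=; apply: eq_bigr => i _.
by rewrite mulr_sumr.
Qed.

(** For [u1 = u2 = u] the constraint reads [u * (v1 + v2) = N], so [w = v1 + v2] becomes the
    summation variable. *)
Lemma diagonal_sumE N (F : nat -> nat -> rat) :
  \sum_(p : ('I_N.+1 * 'I_N.+1) * ('I_N.+1 * 'I_N.+1) |
     two_col p && (p.1.1 == p.1.2)) F p.2.1 p.2.2 =
  \sum_(u < N.+1) \sum_(w < N.+1 | [&& 0 < u, 0 < w & u * w == N]%N)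
     \sum_(v < w | (0 < v)%N) F v (w - v)%N.
Proof.
pose P (u1 u2 v1 v2 : 'I_N.+1) := two_col ((u1, u2), (v1, v2)) && (u1 == u2).
transitivity (\sum_(u1 < N.+1) \sum_(u2 < N.+1) \sum_(v1 < N.+1)
    \sum_(v2 < N.+1 | P u1 u2 v1 v2) F v1 v2).
  rewrite pair_bigA /=; under [RHS]eq_bigr => u _ do rewrite pair_big_dep.
  by rewrite pair_big_dep; apply: eq_big => [[[u1 u2] [v1 v2]]|].
apply: eq_bigr => u _; rewrite (bigD1 u) //= addrC big1 ?add0r; last first.
  move=> u2 nu; rewrite big1 // => v1 _; rewrite big1 // => v2 /andP[_ /eqP E].
  by rewrite E eqxx in nu.
have [u0|u0] := posnP u.
  rewrite big1; last first.
    by move=> v1 _; rewrite big1 // => v2; rewrite /P /two_col /= u0.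
  by rewrite big1 // => w; rewrite u0.
transitivity (\sum_(v < N.+1)
   \sum_(w < N.+1 | [&& 0 < w, u * w == N, 0 < v & v < w]%N) F v (w - v)%N); last first.
  rewrite (exchange_big_dep
    (fun w : 'I_N.+1 => (0 < w) && (u * w == N))%N) /=; last first.
    by move=> v w _ /and4P [-> -> _ _].
  apply: eq_bigr => w /andP [-> ->] /=.
  by rewrite (big_ord_widen_cond N.+1 (fun v => 0 < v)%N
    (fun v => F v (w - v)%N)) // ltnW.
apply: eq_bigr => v1 _.
rewrite (reindex_onto (fun w : 'I_N.+1 => inord (w - v1)%N : 'I_N.+1)
  (fun v2 : 'I_N.+1 => inord (v1 + v2)%N : 'I_N.+1)) /=; last first.
  move=> v2; rewrite /P /two_col /= => /andP [/and5P [_ _ v10 v20 /eqP E] _].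
  by apply: val_inj; rewrite /= inordK inordK ?addKn //; have := ltn_ord v2; nia.
have vM (w : 'I_N.+1) : (inord (w - v1)%N : 'I_N.+1) = (w - v1)%N :> nat.
  by rewrite inordK //; have := ltn_ord w; lia.
apply: eq_big => [w|w _]; last by rewrite vM.
rewrite /P /two_col /= eqxx andbT vM.
apply/idP/idP.
  move=> /andP [/and5P [u1 _ v10 v20 /eqP E] _].
  rewrite -mulnDr subnKC in E; last lia.
  by rewrite v10 E eqxx /=; lia.
move=> /and4P [w0 /eqP E v10 vw].
rewrite -mulnDr subnKC ?E ?eqxx ?subn_gt0 ?u0 ?v10 ?vw ?andbT /=; last exact: ltnW.
by rewrite inord_val.
Qed.

(** The monomial of degree [i.+1] contributes [(i.+1)!] times [bracket [:: i.+2]]. A constant term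
    would bring in the non-admissible [bracket [:: 1]]. *)
Lemma bracket1_poly (p : {poly rat}) (d : nat) :
  (size p <= d.+1)%N -> p.[0] = 0 ->
  Fil_adm d.+1 1 (fun N => if (0 < N)%N then
    \sum_(u < N.+1) \sum_(w < N.+1 | [&& 0 < u, 0 < w & u * w == N]%N) p.[w%:R]
  else 0).
Proof.
move=> sp p0.
have -> : (fun N => if (0 < N)%N then
    \sum_(u < N.+1) \sum_(w < N.+1 | [&& 0 < u, 0 < w & u * w == N]%N) p.[w%:R]
  else 0) = \sum_(i < d) (p`_i.+1 * (i.+1)`!%:R) *: bracket [:: i.+2] :> qseries.
  apply/funext => N; rewrite fct_sumE.
  case: ifP => N0; last first.
    by rewrite big1 // => i _; rewrite /bracket /= fctE N0 scaler0.
  transitivity (\sum_(i < d) p`_i.+1 * (sigma [:: i.+1] N)%:R : rat); last first.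
    apply: eq_bigr => i _; rewrite /bracket fctE N0 big_cons big_nil muln1 /=.
    rewrite -[RHS]/(_ * _ : rat) -mulrA; congr (_ * _).
    by rewrite mulrCA divff ?mulr1 // pnatr_eq0 -lt0n fact_gt0.
  under [RHS]eq_bigr => i _.
    rewrite sigma1E natr_sum mulr_sumr.
    under eq_bigr => u _ do rewrite natr_sum mulr_sumr.
    over.
  rewrite exchange_big /=; apply: eq_bigr => u _.
  rewrite exchange_big /=; apply: eq_bigr => w _.
  rewrite (horner_coef_wide _ sp) big_ord_recl -horner_coef0 p0 mul0r add0r.
  by apply: eq_bigr => i _; rewrite natrX.
apply: lin_span_sum => i _; apply: lin_spanZ.
by apply: Fil_adm_bracket; rewrite //= addn0; have := ltn_ord i.
Qed.

(** * The double shuffle relations *)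

Lemma fact_neq0 m : m`!%:R != 0 :> rat.
Proof. by rewrite pnatr_eq0 -lt0n fact_gt0. Qed.

(** Divided powers absorb the factorials that normalise brackets: the [i]-th monomial is the summand
    of [bracket [:: i.+1; (n - i).+1]]. *)
Definition divided_form n (mu : nat -> rat) (x y : nat) : rat :=
  \sum_(i < n.+1) mu i * (x%:R ^+ i / i`!%:R * (y%:R ^+ (n - i) / (n - i)`!%:R)).

Lemma divided_formC n mu x y : (forall i, (i <= n)%N -> mu (n - i)%N = mu i) ->
  divided_form n mu x y = divided_form n mu y x.
Proof.
move=> mu_sym; rewrite /divided_form (reindex_inj rev_ord_inj) /=.
apply: eq_bigr => i _; have ilen : (i <= n)%N by rewrite -ltnS.
by rewrite subSS mu_sym // subKn // [X in _ * X]mulrC.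
Qed.

Lemma divided_form_diag n (mu : nat -> rat) x :
  \sum_(i < n.+1) 'C(n, i)%:R * mu i = 0 ->
  divided_form n mu x x = 0.
Proof.
move=> mu0.
rewrite -[RHS](mulr0 (x%:R ^+ n / n`!%:R)) -mu0 mulr_sumr; apply: eq_bigr => i _.
have ilen : (i <= n)%N by rewrite -ltnS.
have f1 := fact_neq0 i; have f2 := fact_neq0 (n - i).
have := fact_neq0 n; rewrite -(bin_fact ilen) !natrM => f3.
have -> : x%:R ^+ n = x%:R ^+ i * x%:R ^+ (n - i) :> rat by rewrite -exprD subnKC.
field.
by rewrite f1 f2; move: f3; rewrite !mulf_eq0 !negb_or => /and3P [->].
Qed.

(** Symmetry moves [x + y] to the second slot. The binomial theorem then produces
    [x ^ m / m! * x ^ l / l!], which is ['C(l + m, m)] times the divided power of degree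
    [i = l + m]. *)
Lemma divided_form_shift n mu x y : (forall i, (i <= n)%N -> mu (n - i)%N = mu i) ->
  divided_form n mu (x + y)%N x =
  divided_form n (fun i => \sum_(m < i.+1) 'C(i, m)%:R * mu m) x y.
Proof.
move=> mu_sym; rewrite divided_formC // /divided_form.
transitivity (\sum_(i < n.+1) \sum_(m < n.+1) 'C(i, m)%:R * mu m *
    (x%:R ^+ i / i`!%:R * (y%:R ^+ (n - i) / (n - i)`!%:R))); last first.
  apply: eq_bigr => i _; rewrite mulr_suml.
  rewrite (big_ord_widen n.+1 (fun m => 'C(i, m)%:R * mu m *
    (x%:R ^+ i / i`!%:R * (y%:R ^+ (n - i) / (n - i)`!%:R))) (ltn_ord i)).
  rewrite [RHS]big_mkcond /=. apply: eq_bigr => m _; case: ltnP => // im.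
  by rewrite bin_small // !mul0r.
rewrite exchange_big /=; apply: eq_bigr => m _.
have mn : (m <= n)%N by rewrite -ltnS.
rewrite -(big_mkord xpredT (fun i => 'C(i, m)%:R * mu m *
    (x%:R ^+ i / i`!%:R * (y%:R ^+ (n - i) / (n - i)`!%:R)))).
rewrite (big_cat_nat _ (leqW mn)) //= [X in _ = X + _]big_nat_cond.
rewrite [X in _ = X + _]big1 ?add0r; last first.
  by move=> i /andP [/andP [_ im] _]; rewrite bin_small // !mul0r.
rewrite -[X in _ = \sum_(X <= _ < _) _]add0n big_addn subSn // big_mkord.
rewrite natrD [x%:R + _]addrC exprDn mulr_suml !mulr_sumr; apply: eq_bigr => l _.
have lnm : (l <= n - m)%N by rewrite -ltnS.
have -> : (n - (l + m) = n - m - l)%N by lia.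
have e1 := bin_fact lnm.
have e2 : ('C(l + m, m) * (m`! * l`!) = (l + m)`!)%N.
  by rewrite -{2}(addnK m l) bin_fact // leq_addl.
have f1 := fact_neq0 m; have f2 := fact_neq0 l; have f3 := fact_neq0 (n - m - l).
have f4 := fact_neq0 (n - m); have f5 := fact_neq0 (l + m).
have E1 : 'C(n - m, l)%:R = (n - m)`!%:R / (l`!%:R * (n - m - l)`!%:R) :> rat.
  by rewrite -e1 !natrM mulfK // mulf_neq0.
have E2 : 'C(l + m, m)%:R = (l + m)`!%:R / (m`!%:R * l`!%:R) :> rat.
  by rewrite -e2 !natrM mulfK // mulf_neq0.
rewrite -[_ * _ *+ _]mulr_natr E1 E2 exprD; field.
by rewrite f1 f2 f3 f4 f5.
Qed.

Lemma divided_form_convolution n mu : (0 < n)%N -> exists p : {poly rat},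
  [/\ (size p <= n.+2)%N, p.[0] = 0 &
      forall w : nat,
        p.[w%:R] = \sum_(v < w | (0 < v)%N) divided_form n mu v (w - v)%N].
Proof.
move=> n0.
have /fin_all_exists [P PE] (i : 'I_n.+1) : exists p : {poly rat},
    [/\ (size p <= n.+2)%N, p.[0] = 0 &
      forall w : nat, p.[w%:R] =
        \sum_(v < w | (0 < v)%N) v%:R ^+ i * (w - v)%:R ^+ (n - i)].
  have := @power_convolution i (n - i).
  by rewrite subnKC; [exact|rewrite -ltnS].
exists (\sum_(i < n.+1) (mu i / (i`!%:R * (n - i)`!%:R)) *: P i); split.
- apply: (leq_trans (size_sum _ _ _)); apply/bigmax_leqP => i _.
  by apply: (leq_trans (size_scale_leq _ _)); have [] := PE i.
- rewrite horner_sum big1 // => i _.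
  by have [_ E _] := PE i; rewrite hornerZ E mulr0.
- move=> w; rewrite horner_sum /divided_form exchange_big /=.
  apply: eq_bigr => i _; have [_ _ E] := PE i; rewrite hornerZ E mulr_sumr.
  apply: eq_bigr => v _; have f1 := fact_neq0 i; have f2 := fact_neq0 (n - i).
  by field; rewrite f1 f2.
Qed.

(** The length-two combination equals half the diagonal sum [u1 = u2], whose inner sums are values
    of a polynomial of degree at most [n.+1] without constant term. *)
Lemma bracket_relation n (mu : nat -> rat) : (0 < n)%N ->
  (forall i, (i <= n)%N -> mu (n - i)%N = mu i) ->
  \sum_(i < n.+1) 'C(n, i)%:R * mu i = 0 ->
  Fil_adm n.+2 1 (\sum_(i < n)
    (\sum_(m < i.+1) 'C(i.+1, m)%:R * mu m) *:
      bracket [:: i + 2; n.+2 - (i + 2)]%N).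
Proof.
move=> n0 mu_sym mu0.
have [p [sp p0 pE]] := divided_form_convolution mu n0.
have := lin_spanZ 2^-1 (bracket1_poly sp p0).
congr (lin_span _ _); apply/funext => N; rewrite fct_sumE fctE.
have [->|N0] := posnP N.
  by rewrite scaler0 big1 // => i _; rewrite fctE /bracket scaler0.
under eq_bigr => u _ do under eq_bigr => w _ do rewrite pE.
rewrite -diagonal_sumE -strict_sum_relation; last first.
- by move=> x; apply: divided_form_diag.
- by move=> x y; apply: divided_formC.
have half (s : rat) : 2^-1 * (s *+ 2) = s by field.
rewrite -[LHS]/(_ * _ : rat) half.
transitivity (strict_sum N (fun x y => \sum_(i < n)
  (\sum_(m < i.+1) 'C(i.+1, m)%:R * mu m) *
  (x%:R ^+ i.+1 / i.+1`!%:R * (y%:R ^+ (n - i.+1) / (n - i.+1)`!%:R)))).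
  apply: eq_bigr => p' _; rewrite divided_form_shift // /divided_form -sumrB.
  (* The term [i = 0], which would give the non-admissible [bracket [:: 1; n.+1]], has coefficient
     [mu 0 - mu 0]. In the others, subtracting [F x y] cancels the top summand [m = i]. *)
  rewrite big_ord_recl big_ord1 bin0 mul1r subrr add0r; apply: eq_bigr => i _.
  rewrite -mulrBl; congr (_ * _).
  by rewrite big_ord_recr /= binn mul1r addrK.
rewrite strict_sum_sum; apply: eq_bigr => i _.
rewrite fctE -[RHS]/(_ * _ : rat) -bracket2E // addn2 !subSS subnSK //.
Qed.

(** * Independence of the relations *)

Section RelationVector.
Variables n m r : nat.

(** Entry [t] of [x] is the value at [t.+1] and, by symmetry, at [n - t.+1]; the values at [0] and
    [n] are 0. *)
Definition sym_extension (x : 'rV[rat]_m) (i : nat) : rat :=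
  \sum_(t < m) x ord0 t * (t.+1 == minn i (n - i))%:R.

(** The end values, whose binomial weights are 1, each absorb half of the weighted sum; this
    enforces [F(x, x) = 0] and keeps the symmetry. *)
Definition balanced_extension (x : 'rV[rat]_m) (i : nat) : rat :=
  sym_extension x i - ((i == 0) || (i == n))%N%:R / 2 *
    \sum_(j < n.+1) 'C(n, j)%:R * sym_extension x j.

Definition relation_vector (x : 'rV[rat]_m) : 'rV[rat]_r :=
  \row_j \sum_(i < j.+1) 'C(j.+1, i)%:R * balanced_extension x i.

Lemma sym_extension_linear a x y i :
  sym_extension (a *: x + y) i = a * sym_extension x i + sym_extension y i.
Proof.
rewrite /sym_extension mulr_sumr -big_split; apply: eq_bigr => t _ /=.
by rewrite !mxE mulrDl mulrA.
Qed.

Lemma balanced_extension_linear a x y i :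
  balanced_extension (a *: x + y) i =
  a * balanced_extension x i + balanced_extension y i.
Proof.
rewrite /balanced_extension.
have -> : \sum_(j < n.+1) 'C(n, j)%:R * sym_extension (a *: x + y) j =
   a * (\sum_(j < n.+1) 'C(n, j)%:R * sym_extension x j) +
   \sum_(j < n.+1) 'C(n, j)%:R * sym_extension y j.
  rewrite mulr_sumr -big_split; apply: eq_bigr => j _ /=.
  by rewrite sym_extension_linear; ring.
by rewrite sym_extension_linear; ring.
Qed.

Lemma relation_vector_linear : linear relation_vector.
Proof.
move=> a x y; apply/rowP => j; rewrite !mxE mulr_sumr -big_split.
by apply: eq_bigr => i _ /=; rewrite balanced_extension_linear; ring.
Qed.

HB.instance Definition _ :=
  GRing.isLinear.Build rat 'rV[rat]_m 'rV[rat]_r *:%R relation_vector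
    relation_vector_linear.

Lemma balanced_extension_sym x i :
  (i <= n)%N -> balanced_extension x (n - i)%N = balanced_extension x i.
Proof.
move=> ilen; rewrite /balanced_extension /sym_extension subKn // minnC.
by congr (_ - _%:R / _ * _); lia.
Qed.

Lemma balanced_extension_sum x : (0 < n)%N ->
  \sum_(i < n.+1) 'C(n, i)%:R * balanced_extension x i = 0.
Proof.
rewrite /balanced_extension;
  set S := \sum_(j < n.+1) 'C(n, j)%:R * sym_extension x j => n0.
under eq_bigr do rewrite mulrBr mulrA.
rewrite sumrB -mulr_suml; set c := \sum_(i < n.+1) 'C(n, i)%:R * (_ / 2).
suff -> : c = 1 by rewrite mul1r subrr.
rewrite /c; case: n n0 => // n' _; rewrite big_ord_recl big_ord_recr /= big1.
  by rewrite bin0 binn eqxx /=; field.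
by move=> i _; rewrite /bump /= eqSS ltn_eqF ?mul0r ?mulr0.
Qed.

(** If the values of [mu] below [i] vanish, coordinate [i] reduces to [i.+1] times [mu i]. Hence
    [mu] vanishes below [n], a range containing all the free values. *)
Lemma relation_vector_inj x :
  (1 < n)%N -> (m <= n./2)%N -> r = n -> relation_vector x = 0 -> x = 0.
Proof.
move=> n1 mn rn x0.
have mu0 i : (i < n)%N -> balanced_extension x i = 0.
  elim/ltn_ind: i => i IH ilt.
  have ir : (i < r)%N by rewrite rn.
  have /rowP/(_ (Ordinal ir)) := x0; rewrite !mxE /= big_ord_recr /= big1.
    by rewrite add0r binSn => /eqP; rewrite mulf_eq0 pnatr_eq0 => /eqP.
  by move=> j _; rewrite IH ?mulr0 //; have := ltn_ord j; lia.
apply/rowP => t; rewrite mxE.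
have tm := ltn_ord t; have tn : (t.+1 < n)%N by lia.
have := mu0 _ tn; rewrite /balanced_extension (ltn_eqF tn) /= !mul0r
   subr0 /sym_extension.
(* Since [t.+1 <= n./2], the minimum selects exactly the entry [t] of [x]. *)
have -> : (minn t.+1 (n - t.+1) = t.+1)%N by lia.
rewrite (bigD1 t) //= eqxx mulr1 big1 ?addr0 // => s st.
by rewrite eqSS -[_ == _]/(s == t) (negbTE st) mulr0.
Qed.

End RelationVector.

Theorem mainTheorem6 (k : nat) (hk : (4 <= k)%N) :
  exists U : {vspace 'rV[rat]_(k - 2)},
    (forall c : 'rV[rat]_(k - 2), c \in U <-> gr_relation c) /\
    (k./2 - 1 <= \dim U)%N.
Proof.
have [||U UE] := @vspace_of_prop _ _ (@gr_relation k).
- by apply/gr_relationE; rewrite bracket_comb0; apply: gr_denom0.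
- move=> a x y /gr_relationE kx /gr_relationE ky; apply/gr_relationE.
  by rewrite bracket_combP; apply: gr_denomP.
exists U; split=> //.
pose n := (k - 2)%N.
pose phi := linfun (@relation_vector n (k./2 - 1)%N (k - 2)%N).
(* There are [k./2 - 1 = n./2] free values, and [phi] is injective on them. *)
have -> : (k./2 - 1)%N = \dim (limg phi).
  rewrite limg_dim_eq; first by rewrite dimvf /dim /= mul1n.
  apply/eqP; rewrite -subv0; apply/subvP => x; rewrite memv_cap memv_ker lfunE /=.
  move=> /andP [_ /eqP x0]; rewrite memv0; apply/eqP.
  by apply: relation_vector_inj x0; rewrite /n //; lia.
apply: dimvS; apply/subvP => _ /memv_imgP [x _ ->]; rewrite lfunE /=.
(* It suffices that the combination lies in the length-one step [Fil_adm k 1]. *)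
apply/UE/gr_relationE/Fil_adm_gr_denom.
have n0 : (0 < n)%N by rewrite /n; lia.
have := @bracket_relation n _ n0 (@balanced_extension_sym n _ x)
  (balanced_extension_sum x n0).
have -> : n.+2 = k by rewrite /n; lia.
congr (lin_span _ _); rewrite /bracket_comb -/n.
by apply: eq_bigr => j _; rewrite mxE.
Qed.
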